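(* Let $n\in\mathbb{N}$. Every theorem of $\mathit{I\Sigma}_{n+1}$ is provable in $\mathsf{S}_n$; that is, if $\mathit{I\Sigma}_{n+1}\vdash\varphi$, then there is a regular $\Pi_{n+1}$-restricted $\infty$-proof whose root is marked by the sequent $\{\varphi\}$.
   Context: **Formulas and sequents.** Arithmetical terms are built from individual variables $\mathit{Var}=\{x_0,x_1,\dots\}$ and the constant $0$ by the unary symbol $s$ and the binary symbols $+,\cdot$. Arithmetical formulas are given by $\varphi::=t=t\mid t\neq t\mid(\varphi\wedge\varphi)\mid(\varphi\vee\varphi)\mid\forall y\,\varphi\mid\exists y\,\varphi$. Negation $\overline{\varphi}$ is the syntactic operation swapping $=$ with $\neq$, $\wedge$ with $\vee$, $\forall$ with $\exists$ (so $\overline{\overline\varphi}=\varphi$). Put $\bot:=0\neq 0$, $\varphi\to\psi:=\overline\varphi\vee\psi$. $x\leq y$ abbreviates $\exists z\,(z+x=y)$. $\varphi[y\mapsto t]$ is the substitution of $t$ for all free occurrences of $y$ (no variable of $t$ may become bound). A sequent is a finite multiset of formulas, interpreted as $\bigvee\Gamma$ (with $\bigvee\emptyset:=\bot$); the comma denotes multiset union. $\mathit{FV}$ denotes the set of free variables. **Classes.** Bounded quantifiers: $\forall y\leq t\,\varphi:=\forall y(y\leq t\to\varphi)$, $\exists y\leq t\,\varphi:=\exists y(y\leq t\wedge\varphi)$, with $y$ not in $t$. $\Delta_0=\Sigma_0=\Pi_0$ is the set of formulas built from atomic formulas by logical connectives and bounded quantifiers only. A formula is $\Sigma_{n+1}$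 (resp. $\Pi_{n+1}$) if it is obtained from $\Pi_n$ (resp. $\Sigma_n$) formulas using existential (resp. universal) quantifiers and $\wedge,\vee$. **Theories.** Robinson's arithmetic $\mathsf{Q}$: first-order logic with equality plus (universal closures of) $\neg s(x)=0$; $s(x)=s(y)\to x=y$; $x=0\vee\exists y\,x=s(y)$; $x+0=x$; $x+s(y)=s(x+y)$; $x\cdot0=0$; $x\cdot s(y)=x\cdot y+x$. $\mathit{I\Sigma}_n$ is $\mathsf{Q}$ plus the induction schema $\varphi(0)\wedge\forall x(\varphi(x)\to\varphi(s(x)))\to\forall x\,\varphi(x)$ for all $\Sigma_n$ formulas $\varphi$ (possibly with other free variables). **Calculus $\mathsf{SQ}$.** Initial sequents: $\Gamma,t_0=t_1,t_0\neq t_1$ and $\Gamma,s(t)\neq0$. Rules (premisses / conclusion): $(\wedge)$: $\Gamma,\varphi$ and $\Gamma,\psi$ / $\Gamma,\varphi\wedge\psi$; $(\vee)$: $\Gamma,\varphi,\psi$ / $\Gamma,\varphi\vee\psi$; $(\forall)$: $\Gamma,\varphi[y\mapsto z]$ / $\Gamma,\forall y\,\varphi$, where $z\notin\mathit{FV}(\Gamma,\forall y\,\varphi)$ ($z$ is the active variable); $(\exists)$: $\Gamma,\varphi[y\mapsto t],\exists y\,\varphi$ / $\Gamma,\exists y\,\varphi$; $(\mathsf{ref})$: $\Gamma,t\neq t$ / $\Gamma$; $(\mathsf{rep})$: $\Gamma,t_0\neq t_1,(u_0\neq u_1)[y\mapsto t_0],(u_0\neq u_1)[y\mapsto t_1]$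 / $\Gamma,t_0\neq t_1,(u_0\neq u_1)[y\mapsto t_0]$; $(\mathsf{add}_0)$: $\Gamma,t+0\neq t$ / $\Gamma$; $(\mathsf{add}_s)$: $\Gamma,t+s(u)\neq s(t+u)$ / $\Gamma$; $(\mathsf{mult}_0)$: $\Gamma,t\cdot0\neq0$ / $\Gamma$; $(\mathsf{mult}_s)$: $\Gamma,t\cdot s(u)\neq t\cdot u+t$ / $\Gamma$; $(\mathsf{pred})$: $\Gamma,s(t_0)\neq s(t_1),t_0\neq t_1$ / $\Gamma,s(t_0)\neq s(t_1)$; $(\mathsf{case})$: left premiss $\Gamma[y\mapsto0]$ and right premiss $\Gamma[y\mapsto s(y)]$ / $\Gamma$, where $y\in\mathit{FV}(\Gamma)$ ($y$ is the active variable); $(\mathsf{weak})$: $\Gamma$ / $\Gamma,\Delta$; $(\mathsf{cut})$: left premiss $\Gamma,\varphi$ and right premiss $\Gamma,\overline\varphi$ / $\Gamma$. **$\infty$-proofs.** An $\infty$-proof is a possibly infinite tree whose nodes are marked by sequents, constructed according to the rules of $\mathsf{SQ}$, with every leaf marked by an initial sequent, such that every infinite branch has a tail satisfying: (a) the tail does not pass through left premisses of $(\mathsf{case})$; (b) if the tail passes through the right premiss $\Gamma[z\mapsto s(z)]$ of $(\mathsf{case})$, then after that application the tail does not intersect applications of $(\forall)$ with active variable $z$; (c) for some variable $y$, the tail passes through the right premiss of $(\mathsf{case})$ with active variable $y$ infinitely many times. An $\infty$-proof is $\Pi_m$-restricted if every infinite branch has a tail satisfying (a)–(c) and: (d) if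 the tail passes through the left (right) premiss of $(\wedge)$, then $\varphi$ ($\psi$) is in $\Pi_m$; (e) if the tail intersects an application of $(\forall)$, then $\varphi[y\mapsto z]\in\Pi_m$; (f) if the tail passes through the left (right) premiss of $(\mathsf{cut})$, then $\varphi$ ($\overline\varphi$) is in $\Pi_m$; (g) if the tail passes through the right premiss $\Gamma[z\mapsto s(z)]$ of $(\mathsf{case})$, then $z$ occurs freely only in $\Pi_m$-formulas of $\Gamma$. An $\infty$-proof is regular if it contains only finitely many non-isomorphic subtrees with respect to the marking of sequents. *)

(* Defs.v *)
From HB Require Import structures.
From mathcomp Require Export all_boot.
From mathcomp Require Export finmap multiset.

Set Implicit Arguments.
Unset Strict Implicit.
Unset Printing Implicit Defensive.

Local Open Scope nat_scope.
Local Open Scope mset_scope.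

(* Variables are natural numbers: Var i is x_i. *)

Inductive term : Type :=
  | Var of nat
  | Zero
  | Succ of term
  | Add of term & term
  | Mul of term & term.

Inductive formula : Type :=
  | Eq of term & term
  | Neq of term & term
  | And of formula & formula
  | Or of formula & formula
  | All of nat & formula
  | Ex of nat & formula.

(* Encodings into generic trees give the choiceType structures that
   {mset formula} requires. *)

Fixpoint term_enc (t : term) : GenTree.tree nat :=
  match t with
  | Var x => GenTree.Leaf x
  | Zero => GenTree.Node 0 [::]
  | Succ u => GenTree.Node 1 [:: term_enc u]
  | Add u v => GenTree.Node 2 [:: term_enc u; term_enc v]
  | Mul u v => GenTree.Node 3 [:: term_enc u; term_enc v]
  end.

Fixpoint term_dec (g : GenTree.tree nat) : term :=
  match g with
  | GenTree.Leaf x => Var x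
  | GenTree.Node 1 [:: u] => Succ (term_dec u)
  | GenTree.Node 2 [:: u; v] => Add (term_dec u) (term_dec v)
  | GenTree.Node 3 [:: u; v] => Mul (term_dec u) (term_dec v)
  | _ => Zero
  end.

Lemma term_encK : cancel term_enc term_dec.
Proof. by elim=> //= [t ->|t -> u ->|t -> u ->]. Qed.

HB.instance Definition _ := Countable.copy term (can_type term_encK).

Fixpoint formula_enc (phi : formula) : GenTree.tree (term + nat) :=
  match phi with
  | Eq t u => GenTree.Node 0 [:: GenTree.Leaf (inl t); GenTree.Leaf (inl u)]
  | Neq t u => GenTree.Node 1 [:: GenTree.Leaf (inl t); GenTree.Leaf (inl u)]
  | And a b => GenTree.Node 2 [:: formula_enc a; formula_enc b]
  | Or a b => GenTree.Node 3 [:: formula_enc a; formula_enc b]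
  | All y a => GenTree.Node 4 [:: GenTree.Leaf (inr y); formula_enc a]
  | Ex y a => GenTree.Node 5 [:: GenTree.Leaf (inr y); formula_enc a]
  end.

Fixpoint formula_dec (g : GenTree.tree (term + nat)) : formula :=
  match g with
  | GenTree.Node 0 [:: GenTree.Leaf (inl t); GenTree.Leaf (inl u)] => Eq t u
  | GenTree.Node 1 [:: GenTree.Leaf (inl t); GenTree.Leaf (inl u)] => Neq t u
  | GenTree.Node 2 [:: a; b] => And (formula_dec a) (formula_dec b)
  | GenTree.Node 3 [:: a; b] => Or (formula_dec a) (formula_dec b)
  | GenTree.Node 4 [:: GenTree.Leaf (inr y); a] => All y (formula_dec a)
  | GenTree.Node 5 [:: GenTree.Leaf (inr y); a] => Ex y (formula_dec a)
  | _ => Eq Zero Zero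
  end.

Lemma formula_encK : cancel formula_enc formula_dec.
Proof. by elim=> //= [a -> b ->|a -> b ->|y a ->|y a ->]. Qed.

HB.instance Definition _ := Countable.copy formula (can_type formula_encK).

Fixpoint neg (phi : formula) : formula :=
  match phi with
  | Eq t u => Neq t u
  | Neq t u => Eq t u
  | And a b => Or (neg a) (neg b)
  | Or a b => And (neg a) (neg b)
  | All y a => Ex y (neg a)
  | Ex y a => All y (neg a)
  end.

Definition bot : formula := Neq Zero Zero.
Definition imp (phi psi : formula) : formula := Or (neg phi) psi.

Fixpoint tvars (t : term) : seq nat :=
  match t with
  | Var x => [:: x]
  | Zero => [::]
  | Succ u => tvars u
  | Add u v | Mul u v => tvars u ++ tvars v
  end.

Fixpoint fv (phi : formula) : seq nat :=
  match phi with
  | Eq t u | Neq t u => tvars t ++ tvars u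
  | And a b | Or a b => fv a ++ fv b
  | All y a | Ex y a => [seq x <- fv a | x != y]
  end.

Fixpoint tsubst (y : nat) (t : term) (u : term) : term :=
  match u with
  | Var x => if x == y then t else Var x
  | Zero => Zero
  | Succ v => Succ (tsubst y t v)
  | Add v w => Add (tsubst y t v) (tsubst y t w)
  | Mul v w => Mul (tsubst y t v) (tsubst y t w)
  end.

(* subst y t phi is phi[y |-> t] only when no variable of t becomes bound,
   that is, when free_for y t phi holds. *)
Fixpoint subst (y : nat) (t : term) (phi : formula) : formula :=
  match phi with
  | Eq u v => Eq (tsubst y t u) (tsubst y t v)
  | Neq u v => Neq (tsubst y t u) (tsubst y t v)
  | And a b => And (subst y t a) (subst y t b)
  | Or a b => Or (subst y t a) (subst y t b)
  | All x a => if x == y then All x a else All x (subst y t a)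
  | Ex x a => if x == y then Ex x a else Ex x (subst y t a)
  end.

Fixpoint free_for (y : nat) (t : term) (phi : formula) : bool :=
  match phi with
  | Eq _ _ | Neq _ _ => true
  | And a b | Or a b => free_for y t a && free_for y t b
  | All x a | Ex x a =>
      (y \notin fv phi) || (x \notin tvars t) && free_for y t a
  end.

(* t <= u, with z the bound variable of the abbreviation *)
Definition leq_fml (z : nat) (t u : term) : formula :=
  Ex z (Eq (Add (Var z) t) u).

Inductive Delta0 : formula -> Prop :=
  | Delta0_Eq t u : Delta0 (Eq t u)
  | Delta0_Neq t u : Delta0 (Neq t u)
  | Delta0_And phi psi : Delta0 phi -> Delta0 psi -> Delta0 (And phi psi)
  | Delta0_Or phi psi : Delta0 phi -> Delta0 psi -> Delta0 (Or phi psi)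
  | Delta0_All y z t phi :
      y \notin tvars t -> z \notin y :: tvars t -> Delta0 phi ->
      Delta0 (All y (imp (leq_fml z (Var y) t) phi))
  | Delta0_Ex y z t phi :
      y \notin tvars t -> z \notin y :: tvars t -> Delta0 phi ->
      Delta0 (Ex y (And (leq_fml z (Var y) t) phi)).

Inductive ex_closure (C : formula -> Prop) : formula -> Prop :=
  | ex_base phi : C phi -> ex_closure C phi
  | ex_And phi psi :
      ex_closure C phi -> ex_closure C psi -> ex_closure C (And phi psi)
  | ex_Or phi psi :
      ex_closure C phi -> ex_closure C psi -> ex_closure C (Or phi psi)
  | ex_Ex y phi : ex_closure C phi -> ex_closure C (Ex y phi).

Inductive all_closure (C : formula -> Prop) : formula -> Prop :=
  | all_base phi : C phi -> all_closure C phi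
  | all_And phi psi :
      all_closure C phi -> all_closure C psi -> all_closure C (And phi psi)
  | all_Or phi psi :
      all_closure C phi -> all_closure C psi -> all_closure C (Or phi psi)
  | all_All y phi : all_closure C phi -> all_closure C (All y phi).

Fixpoint Sigma (n : nat) : formula -> Prop :=
  if n is m.+1 then ex_closure (Pi m) else Delta0
with Pi (n : nat) : formula -> Prop :=
  if n is m.+1 then all_closure (Sigma m) else Delta0.

(* First-order logic with equality: natural deduction from the axioms T under
   the open assumptions G.  Since neg is an involution on formulas,
   nd_RAA also gives negation introduction. *)
Inductive nd (T : formula -> Prop) : seq formula -> formula -> Prop :=
  | nd_axiom G phi : T phi -> nd T G phi
  | nd_assume G phi : phi \in G -> nd T G phi
  | nd_AndI G phi psi : nd T G phi -> nd T G psi -> nd T G (And phi psi)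
  | nd_AndEl G phi psi : nd T G (And phi psi) -> nd T G phi
  | nd_AndEr G phi psi : nd T G (And phi psi) -> nd T G psi
  | nd_OrIl G phi psi : nd T G phi -> nd T G (Or phi psi)
  | nd_OrIr G phi psi : nd T G psi -> nd T G (Or phi psi)
  | nd_OrE G phi psi chi :
      nd T G (Or phi psi) -> nd T (phi :: G) chi -> nd T (psi :: G) chi ->
      nd T G chi
  | nd_AllI G y phi z :
      z \notin fv (All y phi) -> (forall psi, psi \in G -> z \notin fv psi) ->
      free_for y (Var z) phi ->
      nd T G (subst y (Var z) phi) -> nd T G (All y phi)
  | nd_AllE G y phi t :
      free_for y t phi -> nd T G (All y phi) -> nd T G (subst y t phi)
  | nd_ExI G y phi t :
      free_for y t phi -> nd T G (subst y t phi) -> nd T G (Ex y phi)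
  | nd_ExE G y phi z chi :
      z \notin fv (Ex y phi) -> z \notin fv chi ->
      (forall psi, psi \in G -> z \notin fv psi) ->
      free_for y (Var z) phi ->
      nd T G (Ex y phi) -> nd T (subst y (Var z) phi :: G) chi ->
      nd T G chi
  | nd_negE G phi : nd T G phi -> nd T G (neg phi) -> nd T G bot
  | nd_RAA G phi : nd T (neg phi :: G) bot -> nd T G phi
  | nd_refl G t : nd T G (Eq t t)
  | nd_leibniz G y phi t u :
      free_for y t phi -> free_for y u phi ->
      nd T G (Eq t u) -> nd T G (subst y t phi) -> nd T G (subst y u phi).

Definition provable (T : formula -> Prop) (phi : formula) : Prop :=
  nd T [::] phi.

Definition univ_closure (phi : formula) : formula :=
  foldr All phi (undup (fv phi)).

Inductive Q_axiom : formula -> Prop :=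
  | Q_succ_neq0 : Q_axiom (neg (Eq (Succ (Var 0)) Zero))
  | Q_succ_inj :
      Q_axiom (imp (Eq (Succ (Var 0)) (Succ (Var 1))) (Eq (Var 0) (Var 1)))
  | Q_case :
      Q_axiom (Or (Eq (Var 0) Zero) (Ex 1 (Eq (Var 0) (Succ (Var 1)))))
  | Q_add0 : Q_axiom (Eq (Add (Var 0) Zero) (Var 0))
  | Q_addS :
      Q_axiom (Eq (Add (Var 0) (Succ (Var 1))) (Succ (Add (Var 0) (Var 1))))
  | Q_mul0 : Q_axiom (Eq (Mul (Var 0) Zero) Zero)
  | Q_mulS :
      Q_axiom (Eq (Mul (Var 0) (Succ (Var 1)))
                  (Add (Mul (Var 0) (Var 1)) (Var 0))).

Definition induction (x : nat) (phi : formula) : formula :=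
  imp (And (subst x Zero phi) (All x (imp phi (subst x (Succ (Var x)) phi))))
      (All x phi).

Inductive ISigma (n : nat) : formula -> Prop :=
  | ISigma_Q phi : Q_axiom phi -> ISigma n (univ_closure phi)
  | ISigma_induction x phi :
      Sigma n phi -> ISigma n (univ_closure (induction x phi)).

Definition sequent := {mset formula}.

Definition seq_subst (y : nat) (t : term) (G : sequent) : sequent :=
  seq_mset [seq subst y t phi | phi <- enum_mset G].

Definition in_fv (x : nat) (G : sequent) : Prop :=
  exists2 phi, phi \in G & x \in fv phi.

(* Instances of the initial sequents and of the rules of SQ, with all the data
   that determines the conclusion, the premisses and the active variable. *)
Inductive rule : Type :=
  | InitEq of sequent & term & term
  | InitSucc of sequent & term
  | RAnd of sequent & formula & formula
  | ROr of sequent & formula & formula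
  | RAll (G : sequent) (y : nat) (phi : formula) (z : nat)
  | REx (G : sequent) (y : nat) (phi : formula) (t : term)
  | RRef of sequent & term
  | RRep (G : sequent) (t0 t1 : term) (y : nat) (u0 u1 : term)
  | RAdd0 of sequent & term
  | RAddS of sequent & term & term
  | RMult0 of sequent & term
  | RMultS of sequent & term & term
  | RPred of sequent & term & term
  | RCase of sequent & nat
  | RWeak of sequent & sequent
  | RCut of sequent & formula.

Definition conclusion (r : rule) : sequent :=
  match r with
  | InitEq G t0 t1 => G `+` [mset Eq t0 t1; Neq t0 t1]
  | InitSucc G t => G `+` [mset Neq (Succ t) Zero]
  | RAnd G phi psi => G `+` [mset And phi psi]
  | ROr G phi psi => G `+` [mset Or phi psi]
  | RAll G y phi z => G `+` [mset All y phi]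
  | REx G y phi t => G `+` [mset Ex y phi]
  | RRef G t => G
  | RRep G t0 t1 y u0 u1 => G `+` [mset Neq t0 t1; subst y t0 (Neq u0 u1)]
  | RAdd0 G t => G
  | RAddS G t u => G
  | RMult0 G t => G
  | RMultS G t u => G
  | RPred G t0 t1 => G `+` [mset Neq (Succ t0) (Succ t1)]
  | RCase G y => G
  | RWeak G D => G `+` D
  | RCut G phi => G
  end.

Definition premisses (r : rule) : seq sequent :=
  match r with
  | InitEq G t0 t1 => [::]
  | InitSucc G t => [::]
  | RAnd G phi psi => [:: G `+` [mset phi]; G `+` [mset psi]]
  | ROr G phi psi => [:: G `+` [mset phi; psi]]
  | RAll G y phi z => [:: G `+` [mset subst y (Var z) phi]]
  | REx G y phi t => [:: G `+` [mset subst y t phi; Ex y phi]]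
  | RRef G t => [:: G `+` [mset Neq t t]]
  | RRep G t0 t1 y u0 u1 =>
      [:: G `+` [mset Neq t0 t1; subst y t0 (Neq u0 u1);
                      subst y t1 (Neq u0 u1)]]
  | RAdd0 G t => [:: G `+` [mset Neq (Add t Zero) t]]
  | RAddS G t u => [:: G `+` [mset Neq (Add t (Succ u)) (Succ (Add t u))]]
  | RMult0 G t => [:: G `+` [mset Neq (Mul t Zero) Zero]]
  | RMultS G t u => [:: G `+` [mset Neq (Mul t (Succ u)) (Add (Mul t u) t)]]
  | RPred G t0 t1 => [:: G `+` [mset Neq (Succ t0) (Succ t1); Neq t0 t1]]
  | RCase G y => [:: seq_subst y Zero G; seq_subst y (Succ (Var y)) G]
  | RWeak G D => [:: G]
  | RCut G phi => [:: G `+` [mset phi]; G `+` [mset neg phi]]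
  end.

Definition side_condition (r : rule) : Prop :=
  match r with
  | RAll G y phi z =>
      ~ in_fv z (G `+` [mset All y phi]) /\ free_for y (Var z) phi
  | REx G y phi t => free_for y t phi
  | RCase G y => in_fv y G
  | _ => True
  end.

(* A tree is given by its nodes, addressed by the sequence of premiss indices
   leading to them from the root (0 is the only or the left premiss, 1 the
   right one); None stands for the absence of a node.  The sequent marking a
   node is the conclusion of the rule instance stored there. *)
Definition tree := seq nat -> option rule.

Definition marking (p : tree) (a : seq nat) : option sequent :=
  omap conclusion (p a).

Definition is_derivation (p : tree) : Prop :=
  [/\ p [::] <> None,
      forall a r, p a = Some r -> side_condition r
    & forall a i,
        marking p (rcons a i) = obind (fun r => onth (premisses r) i) (p a)].

Definition is_branch (p : tree) (b : nat -> nat) : Prop :=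
  forall k, p (mkseq b k) <> None.

(* the branch b meets r at height k, then goes through premiss i of r *)
Definition passes (p : tree) (b : nat -> nat) (k : nat) (r : rule) (i : nat)
  : Prop := p (mkseq b k) = Some r /\ b k = i.

(* Conditions (a), (b), (c) on the tail of b starting at height m *)
Definition progressing_tail (p : tree) (b : nat -> nat) (m : nat) : Prop :=
  [/\ forall k G y, m <= k -> ~ passes p b k (RCase G y) 0,
      forall k G z, m <= k -> passes p b k (RCase G z) 1 ->
        forall j D y phi, k < j -> p (mkseq b j) <> Some (RAll D y phi z)
    & exists y, forall N, exists k G,
        [/\ m <= k, N <= k & passes p b k (RCase G y) 1]].

(* Conditions (d), (e), (f), (g) on the tail of b starting at height m *)
Definition Pi_tail (l : nat) (p : tree) (b : nat -> nat) (m : nat) : Prop :=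
  forall k, m <= k ->
  [/\ forall G phi psi,
        (passes p b k (RAnd G phi psi) 0 -> Pi l phi) /\
        (passes p b k (RAnd G phi psi) 1 -> Pi l psi),
      forall G y phi z,
        p (mkseq b k) = Some (RAll G y phi z) -> Pi l (subst y (Var z) phi),
      forall G phi,
        (passes p b k (RCut G phi) 0 -> Pi l phi) /\
        (passes p b k (RCut G phi) 1 -> Pi l (neg phi))
    & forall G z, passes p b k (RCase G z) 1 ->
        forall phi, phi \in G -> z \in fv phi -> Pi l phi].

Definition inf_proof (p : tree) : Prop :=
  is_derivation p /\
  forall b, is_branch p b -> exists m, progressing_tail p b m.

Definition Pi_restricted (l : nat) (p : tree) : Prop :=
  forall b, is_branch p b ->
    exists m, progressing_tail p b m /\ Pi_tail l p b m.

(* Every subtree has the same nodes and the same sequents as one of finitely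
   many subtrees; the rule instances need not agree. *)
Definition regular (p : tree) : Prop :=
  exists s : seq (seq nat),
    forall a, p a <> None ->
      exists2 c, c \in s & forall d, marking p (a ++ d) = marking p (c ++ d).

Definition S_provable (n : nat) (phi : formula) : Prop :=
  exists p : tree,
    [/\ inf_proof p, Pi_restricted n.+1 p, regular p
      & marking p [::] = Some [mset phi]].

(* Main.v *)
(* Natural deduction is simulated in SQ by means of cuts, so only the axioms need
   attention.  Induction for a Pi_{n+1} formula phi comes from a proof with one cycle:
   apply (case) to Gamma, phi(x); the right premiss Gamma, phi(s x) is cut with phi(x),
   and the left premiss Gamma, phi(s x), phi(x) of the cut weakens to the root
   Gamma, phi(x).  The only infinite branch of the cycle goes through a right premiss
   of (case) once per turn, and its cuts are on the Pi_{n+1} formula phi(x).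
   Induction for a Sigma_{n+1} formula phi reduces to it, applied in the variable k to
   forall x (x + k = a -> ~ phi(x)). *)

Require Import Defs.
From Stdlib Require Import Classical.
From mathcomp Require Import zify.

Set Implicit Arguments.
Unset Strict Implicit.
Unset Printing Implicit Defensive.

Local Open Scope nat_scope.
Local Open Scope mset_scope.

(** * Composing restricted proofs by rules *)

Definition restricted_proof (l : nat) (p : tree) (G : sequent) : Prop :=
  [/\ is_derivation p, Pi_restricted l p, regular p & marking p [::] = Some G].

Definition derivable (l : nat) (G : sequent) : Prop :=
  exists p, restricted_proof l p G.

Lemma mkseq_shift (b : nat -> nat) c k : mkseq b (size c) = c ->
  mkseq b (size c + k) = c ++ mkseq (fun j => b (size c + j)) k.
Proof.
move=> bc; rewrite -[X in X ++ _]bc /mkseq iotaD map_cat add0n.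
by rewrite -[X in iota X k]addn0 iotaDl -map_comp.
Qed.

(** Conditions (a) to (g) concern tails only: past height [size c] the branch runs in the copy of
    [q], so the tail found for [q] is shifted by [size c]. *)
Lemma tail_graft l p q c b :
    (forall a, p (c ++ a) = q a) -> Pi_restricted l q ->
    is_branch p b -> mkseq b (size c) = c ->
  exists m, progressing_tail p b m /\ Pi_tail l p b m.
Proof.
move=> pq qP pb bc; set b' := fun j => b (size c + j).
have pE k : p (mkseq b (size c + k)) = q (mkseq b' k).
  by rewrite mkseq_shift // pq.
have passE k r i : passes p b (size c + k) r i <-> passes q b' k r i.
  by rewrite /passes pE.
have qb' : is_branch q b' by move=> k; rewrite -pE; apply: pb.
have [m [[ma mb [y mc]] mPi]] := qP b' qb'.
have shift k : size c + m <= k -> exists2 j, k = size c + j & m <= j.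
  move=> le; exists (k - size c); last by rewrite leq_subRL // (leq_trans _ le) ?leq_addr.
  by rewrite subnKC // (leq_trans _ le) ?leq_addr.
exists (size c + m); split; first split.
- by move=> k G z /shift[j -> mj] /passE; apply: ma.
- move=> k G z /shift[j -> mj] /passE qj i D w phi kj.
  have [j' ij' mj'] := shift i (leq_trans (leq_add (leqnn _) mj) (ltnW kj)).
  move: kj; rewrite ij' pE ltn_add2l => jj'.
  exact: mb qj _ _ _ _ jj'.
- exists y => N; have [k [G [mk Nk qk]]] := mc N.
  exists (size c + k), G; split; last exact/passE.
    by rewrite leq_add2l.
  by rewrite (leq_trans Nk) ?leq_addl.
- move=> _ /shift[j -> mj]; have [d e f g] := mPi j mj; split.
  + move=> G phi psi; have [d1 d2] := d G phi psi.
    by split=> /passE; [apply: d1 | apply: d2].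
  + by move=> G z phi w; rewrite pE; apply: e.
  + move=> G phi; have [f1 f2] := f G phi.
    by split=> /passE; [apply: f1 | apply: f2].
  + by move=> G z /passE; apply: g.
Qed.

Definition join_tree (r : rule) (f : nat -> tree) : tree :=
  fun a => if a is i :: a' then f i a' else Some r.

(** Recursion on the list of premisses gathers their proofs into one function. Indices beyond the
    list get the empty tree, so that [join_tree] has no surplus children. *)
Lemma premiss_trees l (s : seq sequent) :
    (forall G, G \in s -> derivable l G) ->
  exists f : nat -> tree, forall i,
    if onth s i is Some G then restricted_proof l (f i) G
    else forall a, f i a = None.
Proof.
elim: s => [|G s IH] sP; first by exists (fun _ _ => None) => i; rewrite onth0n.
have [p pG] := sP G (mem_head _ _).
have [f fP] := IH (fun G' sG' => sP G' (mem_behead (s := G :: s) sG')).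
by exists (fun i => if i is j.+1 then f j else p) => -[|i] //=; apply: fP.
Qed.

(** The representatives of each [f i] are prefixed with [i], which makes them addresses in the
    joined tree, and the finitely many lists are concatenated. *)
Lemma finite_regular (f : nat -> tree) (m : nat) :
    (forall i, i < m -> regular (f i)) ->
  exists s : seq (seq nat), forall i a, i < m -> f i a <> None ->
    exists2 c, c \in s &
      exists2 c', c = i :: c' &
        forall d, marking (f i) (a ++ d) = marking (f i) (c' ++ d).
Proof.
elim: m => [|m IH] reg; first by exists [::].
have [s sP] := IH (fun i im => reg i (leqW im)).
have [t tP] := reg m (leqnn _).
exists ([seq m :: c | c <- t] ++ s) => i a; rewrite ltnS leq_eqVlt.
case/orP=> [/eqP-> /tP[c tc cE] | im /(sP _ _ im)[c sc cE]].
  by exists (m :: c); [rewrite mem_cat map_f | exists c].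
by exists c => //; rewrite mem_cat sc orbT.
Qed.

Lemma derivable_rule l r :
    side_condition r -> (forall G, G \in premisses r -> derivable l G) ->
  derivable l (conclusion r).
Proof.
move=> sr /premiss_trees[f fP].
have fN i : size (premisses r) <= i -> forall a, f i a = None.
  by move=> le; have := fP i; rewrite onth_default.
have fD i : i < size (premisses r) ->
    exists2 G, onth (premisses r) i = Some G & restricted_proof l (f i) G.
  by move=> lt; have := fP i; move: lt; rewrite -onthTE; case: onth => // G; exists G.
exists (join_tree r f); split=> //.
- split=> //.
    move=> [|i a] r' /=; first by case=> <-.
    case: (ltnP i (size (premisses r))) => [/fD[G _ [[_ + _] _ _ _]]|/fN->//].
    exact.
  move=> [|i a] j /=.
    rewrite /marking /=; case: (ltnP j (size (premisses r))) => [/fD[G -> []]//|le].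
    by rewrite fN // onth_default.
  rewrite /marking /=.
  case: (ltnP i (size (premisses r))) => [/fD[G _ [[_ _ +] _ _ _]]|/fN E].
    exact.
  by rewrite !E.
(* From height 1 on, the branch lies in the subtree [f (b 0)]; an index without a premiss would
   leave the tree. *)
- move=> b pb; have := pb 1; rewrite /mkseq /= => fb.
  case: (ltnP (b 0) (size (premisses r))) => [/fD[G _ [_ fr _ _]]|/fN]; last first.
    by move/(_ [::]) => fb0.
  exact: (@tail_graft _ _ (f (b 0)) [:: b 0]).
- have [s sP] : exists s : seq (seq nat), forall i a,
      i < size (premisses r) -> f i a <> None -> exists2 c, c \in s &
        exists2 c', c = i :: c' &
          forall d, marking (f i) (a ++ d) = marking (f i) (c' ++ d).
    by apply: finite_regular => i /fD[G _ []].
  (* The whole tree is the only subtree not inside some [f i]; it represents itself. *)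
  exists ([::] :: s) => -[|i a] /= fa; first by exists [::].
  case: (ltnP i (size (premisses r))) => [lt|/fN E]; last by rewrite E in fa.
  have [c sc [c' cE dE]] := sP _ _ lt fa.
  exists c => [|d]; first by rewrite inE sc orbT.
  by rewrite cE; apply: dE.
Qed.

(** * The proof with one cycle *)

Section Loop.

Variables (l : nat) (G : sequent) (x : nat) (phi phi' : formula) (p0 p1 : tree).

(** [p0] hangs at the left premiss of (case) and [p1] at the right premiss of (cut). At address
    [[:: 1; 0; 0]], above (weak), the tree starts afresh. *)
Fixpoint loop (a : seq nat) : option rule :=
  match a with
  | [::] => Some (RCase (G `+` [mset phi]) x)
  | 0 :: a' => p0 a'
  | [:: 1] => Some (RCut (G `+` [mset phi']) phi)
  | [:: 1; 0] => Some (RWeak (G `+` [mset phi]) [mset phi'])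
  | 1 :: 0 :: 0 :: a' => loop a'
  | 1 :: 1 :: a' => p1 a'
  | _ => None
  end.

(** Case analysis along the clauses of [loop]. Off the tree, [None] is supplied for all extensions
    of the address because [is_derivation] also looks at children. *)
Lemma loop_ind (P : seq nat -> Prop) :
  P [::] -> (forall a, P (0 :: a)) -> P [:: 1] -> P [:: 1; 0] ->
  (forall a, P a -> P [:: 1, 0, 0 & a]) -> (forall a, P [:: 1, 1 & a]) ->
  (forall a, (forall d, loop (a ++ d) = None) -> P a) -> forall a, P a.
Proof.
move=> P0 Pl P1 P10 Prec Pr PN a.
(* Induction on the length, since one turn strips three indices at once. *)
elim: {a}_.+1 {-2}a (ltnSn (size a)) => // m IH [//|[|[|i]] a].
- by move=> _; apply: Pl.
- case: a => [//|[|[|i]] a] /=; last by move=> _; apply: PN.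
    case: a => [//|[|i] a] /= lt; last exact: PN.
    by apply/Prec/IH; rewrite -ltnS (leq_trans _ lt) // ltnS (leq_trans _ (leqnSn _)).
  by move=> _; apply: Pr.
- by move=> _; apply: PN.
Qed.

Definition turns (q : nat) : seq nat := flatten (nseq q [:: 1; 0; 0]).

Lemma loop_turns q a : loop (turns q ++ a) = loop a.
Proof. by elim: q. Qed.

Lemma size_turns q : size (turns q) = q * 3.
Proof. by elim: q => //= q ->. Qed.

Lemma turnsS q : turns q.+1 = turns q ++ [:: 1; 0; 0].
Proof. by elim: q => //= q <-. Qed.

(** Avoiding [p0] and [p1] leaves one way through each of the three rules, so the branch repeats the
    indices 1, 0, 0 forever. *)
Lemma loop_branch b :
    is_branch loop b ->
    (forall c, mkseq b (size c) = c ->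
       ~ (forall a, loop (c ++ a) = p0 a) /\ ~ (forall a, loop (c ++ a) = p1 a)) ->
  forall q, [/\ mkseq b (q * 3) = turns q, b (q * 3) = 1,
                b (q * 3).+1 = 0 & b (q * 3).+2 = 0].
Proof.
move=> lb noexit.
have step q : mkseq b (q * 3) = turns q ->
    [/\ b (q * 3) = 1, b (q * 3).+1 = 0 & b (q * 3).+2 = 0].
  move=> bq; have sq := size_turns q.
  have pre k : mkseq b (q * 3 + k) = turns q ++ mkseq (fun j => b (q * 3 + j)) k.
    by rewrite -sq; apply: mkseq_shift; rewrite sq.
  (* At (case), index 0 would enter [p0]. *)
  have b0 : b (q * 3) = 1.
    have := lb (q * 3 + 1); rewrite pre loop_turns /mkseq /= addn0.
    have [|+ _] := noexit (turns q ++ [:: b (q * 3)]).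
      by rewrite size_cat sq pre /mkseq /= addn0.
    case: (b (q * 3)) => [|[|//]] //= E _; case: E => a.
    by rewrite -catA loop_turns.
  (* At (cut), index 1 would enter [p1]. *)
  have b1 : b (q * 3).+1 = 0.
    have := lb (q * 3 + 2); rewrite pre loop_turns /mkseq /= addn0 b0 addn1.
    have [|_] := noexit (turns q ++ [:: 1; b (q * 3).+1]).
      by rewrite size_cat sq pre /mkseq /= addn0 addn1 b0.
    case: (b (q * 3).+1) => [|[|//]] //= E _; case: E => a.
    by rewrite -catA loop_turns.
  split=> //; have := lb (q * 3 + 3).
  rewrite pre loop_turns /mkseq /= addn0 b0 addn1 b1 addn2.
  by case: (b _).
suff turn q : mkseq b (q * 3) = turns q by move=> q; have [] := step q (turn q).
elim: q => // q IH; have [b0 b1 b2] := step q IH.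
rewrite turnsS mulSn addnC -(size_turns q) mkseq_shift ?size_turns //.
by rewrite /mkseq /= addn0 addn1 addn2 b0 b1 b2.
Qed.

Hypotheses (Pi_phi : Pi l phi) (xG : ~ in_fv x G) (xphi : in_fv x (G `+` [mset phi])).
Hypotheses (rightE : seq_subst x (Succ (Var x)) (G `+` [mset phi]) = G `+` [mset phi']).
Hypotheses (proof0 : restricted_proof l p0 (seq_subst x Zero (G `+` [mset phi]))).
Hypotheses (proof1 : restricted_proof l p1 (G `+` [mset phi'] `+` [mset neg phi])).

Lemma loop_derivation : is_derivation loop.
Proof.
have [[_ side0 der0] _ _ root0] := proof0.
have [[_ side1 der1] _ _ root1] := proof1.
split=> //.
  elim/loop_ind=> [r [<-]|a r|r [<-]|r [<-]|a IH r|a r|a aN r] //=.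
  - exact: side0.
  - exact: IH.
  - exact: side1.
  - by have := aN [::]; rewrite cats0 => ->.
elim/loop_ind=> [|a|||a IH|a|a aN] i.
- by case: i => [|[|i]] //=; rewrite /marking /= ?rightE ?onth0n.
- exact: der0.
- case: i => [|[|i]] //=; rewrite /marking /= ?onth0n //.
  (* The left premiss of the cut and the conclusion of (weak) add [phi] and [phi'] in opposite
     orders. *)
  by rewrite msetDAC.
- by case: i => [|i]; rewrite /marking /= ?onth0n.
- exact: IH.
- exact: der1.
- by rewrite -cats1 /marking aN; have := aN [::]; rewrite cats0 => ->.
Qed.

Lemma loop_regular : regular loop.
Proof.
have [_ _ [s0 reg0] _] := proof0; have [_ _ [s1 reg1] _] := proof1.
exists ([:: [::]; [:: 1]; [:: 1; 0]] ++ [seq 0 :: c | c <- s0]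
        ++ [seq [:: 1, 1 & c] | c <- s1]).
elim/loop_ind=> [|a /reg0[c sc cE]|||a IH /IH[c sc cE]|a /reg1[c sc cE]|a].
- by exists [::].
- by exists (0 :: c) => //; rewrite !mem_cat map_f ?orbT.
- by exists [:: 1].
- by exists [:: 1; 0].
(* After a full turn the subtree is literally the one at [a], so its representative serves again. *)
- by exists c.
- exists [:: 1, 1 & c] => //; rewrite !mem_cat.
  by rewrite [X in _ || (_ || X)](map_f (fun c => [:: 1, 1 & c])) ?orbT.
- by move/(_ [::]); rewrite cats0.
Qed.

Lemma loop_restricted : Pi_restricted l loop.
Proof.
have [_ res0 _ _] := proof0; have [_ res1 _ _] := proof1.
move=> b lb.
(* Either the branch enters [p0] or [p1] at some height, and its tail is inherited from there, or it
   stays on the cycle. *)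
have [[c bc [E|E]]|noexit] := classic (exists2 c, mkseq b (size c) = c &
    (forall a, loop (c ++ a) = p0 a) \/ (forall a, loop (c ++ a) = p1 a)).
- exact: tail_graft E res0 lb bc.
- exact: tail_graft E res1 lb bc.
have turn : forall q, [/\ mkseq b (q * 3) = turns q, b (q * 3) = 1,
                b (q * 3).+1 = 0 & b (q * 3).+2 = 0].
  apply: loop_branch => // c bc; split=> E; apply: noexit; exists c; tauto.
have case_at q : passes loop b (q * 3) (RCase (G `+` [mset phi]) x) 1.
  have [bq b0 _ _] := turn q; split=> //.
  by rewrite bq -[turns q]cats0 loop_turns.
have rules k : [\/ passes loop b k (RCase (G `+` [mset phi]) x) 1,
                   passes loop b k (RCut (G `+` [mset phi']) phi) 0 |
                   passes loop b k (RWeak (G `+` [mset phi]) [mset phi']) 0].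
  (* Height [k] is position [k %% 3] of turn [k %/ 3]. *)
  have [bq b0 b1 b2] := turn (k %/ 3).
  have pre j : mkseq b (k %/ 3 * 3 + j) =
      turns (k %/ 3) ++ mkseq (fun i => b (k %/ 3 * 3 + i)) j.
    by rewrite -size_turns; apply: mkseq_shift; rewrite size_turns.
  rewrite (divn_eq k 3); move: (ltn_pmod k (isT : 0 < 3)).
  rewrite /passes pre loop_turns.
  case: (k %% 3) => [|[|[|//]]] _; rewrite /mkseq /= ?addn0 ?addn1 ?addn2 ?b0 ?b1 ?b2.
  - by constructor 1.
  - by constructor 2.
  - by constructor 3.
exists 0; split; first split.
- by move=> k D y _ []; case: (rules k) => [] [-> ->].
(* Condition (b): [RAll] does not occur on the cycle. *)
- by move=> k D z _ _ j D' y psi _; case: (rules j) => [] [-> _].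
(* Condition (c): turn [N] opens with a (case) on [x], at height [N * 3], which is at least [N]. *)
- exists x => N; exists (N * 3), (G `+` [mset phi]); split=> //.
  by rewrite leq_pmulr.
move=> k _; split.
- by move=> D psi chi; split=> -[]; case: (rules k) => [] [-> _].
- by move=> D y psi z; case: (rules k) => [] [-> _].
(* Condition (f): only left premisses of cuts are taken, and the cut formula there is [phi]. *)
- by move=> D psi; split=> -[]; case: (rules k) => [] [-> ->] // [_ <-].
(* Condition (g): [x] is not free in [G], so [phi] is the only formula of the sequent in which it
   can be free. *)
- move=> D z []; case: (rules k) => [] [-> ->] // [<- <-] _ psi.
  rewrite in_msetD in_mset1 => /orP[Gpsi xpsi|/eqP-> //].
  by case: xG; exists psi.
Qed.

Lemma loop_proof : restricted_proof l loop (G `+` [mset phi]).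
Proof.
by split=> //; [exact: loop_derivation|exact: loop_restricted|exact: loop_regular].
Qed.

End Loop.

(** * Negation, substitution and fresh variables *)

Lemma negK : involutive neg.
Proof. by elim=> //= [a -> b ->|a -> b ->|y a ->|y a ->]. Qed.

Lemma fv_neg phi : fv (neg phi) = fv phi.
Proof. by elim: phi => //= [a -> b ->|a -> b ->|y a ->|y a ->]. Qed.

Lemma notin_fv_All y phi : y \notin fv (All y phi).
Proof. by rewrite /= mem_filter eqxx. Qed.

Lemma neg_subst y t phi : neg (subst y t phi) = subst y t (neg phi).
Proof.
by elim: phi => //= [a -> b ->|a -> b ->|x a|x a] //; case: eqP => //= _ ->.
Qed.

Lemma free_for_neg y t phi : free_for y t (neg phi) = free_for y t phi.
Proof.
by elim: phi => //= [a -> b ->|a -> b ->|x a|x a] //; rewrite fv_neg => ->.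
Qed.

Lemma tsubst_id y t u : y \notin tvars u -> tsubst y t u = u.
Proof.
elim: u => //= [x|u IH|u IHu v IHv|u IHu v IHv].
- by rewrite inE eq_sym; case: eqP.
- by move/IH->.
- by rewrite mem_cat => /norP[/IHu-> /IHv->].
- by rewrite mem_cat => /norP[/IHu-> /IHv->].
Qed.

Lemma subst_id y t phi : y \notin fv phi -> subst y t phi = phi.
Proof.
elim: phi => //= [u v|u v|a IHa b IHb|a IHa b IHb|x a IH|x a IH].
1,2: by rewrite mem_cat => /norP[yu yv]; rewrite !tsubst_id.
1,2: by rewrite mem_cat => /norP[/IHa-> /IHb->].
all: by rewrite mem_filter eq_sym; case: eqP => //= _ /IH->.
Qed.

Lemma tsubst_var y u : tsubst y (Var y) u = u.
Proof.
by elim: u => //= [x|u ->|u -> v ->|u -> v ->] //; case: eqP => // ->.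
Qed.

Lemma subst_var y phi : subst y (Var y) phi = phi.
Proof.
by elim: phi => //= [u v|u v|a -> b ->|a -> b ->|x a ->|x a ->]; rewrite ?tsubst_var ?if_same.
Qed.

Lemma tvars_tsubst v x t u :
  v \in tvars (tsubst x t u) -> (v != x) && (v \in tvars u) || (v \in tvars t).
Proof.
elim: u => //= [y|u IHu w IHw|u IHu w IHw].
- by case: eqP => [_ ->|yx]; rewrite ?orbT //= !inE => /eqP->; rewrite eqxx andbT; case: eqP yx.
- by rewrite !mem_cat => /orP[/IHu|/IHw] /orP[/andP[-> ->]|->]; rewrite ?orbT.
- by rewrite !mem_cat => /orP[/IHu|/IHw] /orP[/andP[-> ->]|->]; rewrite ?orbT.
Qed.

Lemma fv_subst v x t phi :
  v \in fv (subst x t phi) -> (v != x) && (v \in fv phi) || (v \in tvars t).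
Proof.
elim: phi => //= [u w|u w|a IHa b IHb|a IHa b IHb|y a IH|y a IH].
1,2: by rewrite !mem_cat => /orP[]/tvars_tsubst /orP[/andP[-> ->]|->]; rewrite ?orbT.
1,2: by rewrite !mem_cat => /orP[/IHa|/IHb] /orP[/andP[-> ->]|->]; rewrite ?orbT.
all: case: eqP => [-> /=|_ /=]; rewrite !mem_filter.
1,3: by case/andP=> -> ->.
all: by case/andP=> -> /IH /orP[/andP[-> ->]|->]; rewrite ?orbT.
Qed.

Lemma fv_subst_closed x t phi : x \notin tvars t -> x \notin fv (subst x t phi).
Proof. by move=> xt; apply/negP => /fv_subst; rewrite eqxx (negPf xt). Qed.

Lemma fv_subst_fresh v x t phi :
  v \notin fv phi -> v \notin tvars t -> v \notin fv (subst x t phi).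
Proof.
by move=> vphi vt; apply/negP => /fv_subst; rewrite (negPf vphi) (negPf vt) andbF.
Qed.

Lemma tsubst_comm x z y u v : x != y -> z != y -> x \notin tvars u ->
  tsubst x (Var z) (tsubst y u v) = tsubst y u (tsubst x (Var z) v).
Proof.
move=> xy zy xu; elim: v => //= [w|v ->|v -> w ->|v -> w ->] //.
have [->|wy] := eqVneq w y; first by rewrite eq_sym (negPf xy) /= eqxx tsubst_id.
by case: eqP => //= wx; rewrite ?(negPf zy) ?wx ?eqxx //= (negPf wy); case: eqP wx.
Qed.

(** Serves the quantifier case of Leibniz's law, where [x] is the bound variable: renaming it to [z]
    leaves [u] alone and creates no new [y]. *)
Lemma subst_comm x z y u phi : x != y -> z != y -> x \notin tvars u ->
  subst x (Var z) (subst y u phi) = subst y u (subst x (Var z) phi).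
Proof.
move=> xy zy xu.
elim: phi => //= [v w|v w|a -> b ->|a -> b ->|w a IH|w a IH] //;
  rewrite ?tsubst_comm //.
all: have [->|wy] := eqVneq w y.
1,3: by rewrite /= eq_sym (negPf xy) /= eqxx.
all: by have [->|wx] /= := eqVneq w x; rewrite ?eqxx ?(negPf xy) ?(negPf wx) ?(negPf wy) //= IH.
Qed.

(** A binder of [y] stops the substitution, and any other binder is absent from [t]. This covers
    passing from [x] to its successor and using a bound variable as its own active variable. *)
Lemma free_for_self y t phi : {subset tvars t <= [:: y]} -> free_for y t phi.
Proof.
move=> ty; elim: phi => //= [a -> b ->|a -> b ->|x a ->|x a ->] //; rewrite mem_filter andbT;
  have [->|xy] := eqVneq y x => //=; apply/orP; right.
all: by apply/negP => /ty; rewrite inE eq_sym (negPf xy).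
Qed.

(** Bound variables are included: a variable outside this list is neither free in the formula nor
    captured when substituted. *)
Fixpoint vars (phi : formula) : seq nat :=
  match phi with
  | Eq t u | Neq t u => tvars t ++ tvars u
  | And a b | Or a b => vars a ++ vars b
  | All y a | Ex y a => y :: vars a
  end.

Lemma fv_vars phi : {subset fv phi <= vars phi}.
Proof.
elim: phi => [t u|t u|a IHa b IHb|a IHa b IHb|y a IH|y a IH] v //=.
1,2: by rewrite !mem_cat => /orP[/IHa|/IHb]->; rewrite ?orbT.
all: by rewrite mem_filter inE => /andP[_ /IH->]; rewrite orbT.
Qed.

Lemma notin_fv z phi : z \notin vars phi -> z \notin fv phi.
Proof. exact/contra/fv_vars. Qed.

Lemma free_for_fresh y z phi : z \notin vars phi -> free_for y (Var z) phi.
Proof.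
elim: phi => //= [a IHa b IHb|a IHa b IHb|x a IH|x a IH].
1,2: by rewrite mem_cat => /norP[/IHa-> /IHb->].
all: by rewrite !inE eq_sym => /norP[-> /IH->]; rewrite orbT.
Qed.

(** Since [z] differs from [y], renaming [x] to [z] adds no free occurrence of [y], hence no new
    place for capture. *)
Lemma free_for_subst y u x z phi :
  z != y -> free_for y u phi -> free_for y u (subst x (Var z) phi).
Proof.
move=> zy; elim: phi => //= [a IHa b IHb|a IHa b IHb|w a IH|w a IH].
1,2: by case/andP=> /IHa-> /IHb->.
all: case: ifP => //= wx /orP[yf|/andP[-> /IH->]]; last by rewrite orbT.
all: apply/orP; left; move: yf; rewrite !mem_filter.
all: apply/contra => /andP[-> /fv_subst].
all: by rewrite inE (eq_sym y z) (negPf zy) orbF => /andP[].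
Qed.

(** Induction on this size replaces structural induction wherever a quantifier is reduced to a
    substitution instance, which has the size of the body. *)
Fixpoint fsize (phi : formula) : nat :=
  match phi with
  | Eq _ _ | Neq _ _ => 0
  | And a b | Or a b => (fsize a + fsize b).+1
  | All _ a | Ex _ a => (fsize a).+1
  end.

Lemma fsize_subst y t phi : fsize (subst y t phi) = fsize phi.
Proof.
by elim: phi => //= [a -> b ->|a -> b ->|x a IH|x a IH] //; case: ifP => //= _; rewrite IH.
Qed.

Lemma formula_size_ind (P : formula -> Prop) :
  (forall phi, (forall psi, fsize psi < fsize phi -> P psi) -> P phi) ->
  forall phi, P phi.
Proof.
move=> step phi; elim: {phi}_.+1 {-2}phi (ltnSn (fsize phi)) => // m IH phi lt.
by apply: step => psi lt'; apply: IH; apply: leq_trans lt' lt.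
Qed.

Lemma exists_fresh (s : seq nat) : exists z, z \notin s.
Proof.
suff le v : v \in s -> v <= sumn s by exists (sumn s).+1; apply/negP => /le; rewrite ltnn.
elim: s => //= w s IH; rewrite inE => /orP[/eqP->|/IH le]; first exact: leq_addr.
exact: leq_trans le (leq_addl _ _).
Qed.

(** * Negation and the arithmetical hierarchy *)

Lemma Delta0_neg phi : Delta0 phi -> Delta0 (neg phi).
Proof.
elim=> /= [t u|t u|a b _ IHa _ IHb|a b _ IHa _ IHb|y z t a yt zt _ IH|y z t a yt zt _ IH].
1-4: by constructor.
- exact: Delta0_Ex.
- exact: Delta0_All.
Qed.

(** Both halves go through one induction because the two classes alternate: each is built at the
    next level from the other. *)
Lemma Sigma_Pi_neg n :
  (forall phi, Sigma n phi -> Pi n (neg phi)) /\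
  (forall phi, Pi n phi -> Sigma n (neg phi)).
Proof.
elim: n => [|n [IHS IHP]]; first by split; apply: Delta0_neg.
split=> phi /=; elim=> /= [a aC|a b _ IHa _ IHb|a b _ IHa _ IHb|y a _ IH].
- exact/all_base/IHP.
- exact: all_Or.
- exact: all_And.
- exact: all_All.
- exact/ex_base/IHS.
- exact: ex_Or.
- exact: ex_And.
- exact: ex_Ex.
Qed.

Lemma Delta0_Sigma_Pi n phi : Delta0 phi -> Sigma n phi /\ Pi n phi.
Proof.
by move=> d; elim: n => //= n [IHS IHP]; split; [apply: ex_base | apply: all_base].
Qed.

(** * Sequents as lists *)

Lemma seq_mset_add1 (l : seq formula) a : seq_mset l `+` [mset a] = seq_mset (a :: l).
Proof. by rewrite mset_cons msetDC. Qed.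

Lemma seq_mset_add2 (l : seq formula) a b :
  seq_mset l `+` [mset a; b] = seq_mset [:: a, b & l].
Proof. by rewrite !mset_cons msetDC msetDA. Qed.

Lemma seq_mset_add3 (l : seq formula) a b c :
  seq_mset l `+` [mset a; b; c] = seq_mset [:: a, b, c & l].
Proof. by rewrite !mset_cons msetDC !msetDA. Qed.

Definition seq_mset_add := (seq_mset_add1, seq_mset_add2, seq_mset_add3).

Lemma mem_seq_mset (l : seq formula) phi : (phi \in seq_mset l) = (phi \in l).
Proof. by rewrite in_mset mset_seqE -has_count has_pred1. Qed.

Lemma seq_subst_seq_mset y t l :
  seq_subst y t (seq_mset l) = seq_mset [seq subst y t phi | phi <- l].
Proof. exact/eq_seq_msetP/perm_map/perm_eq_seq_mset. Qed.

Definition fresh (z : nat) (l : seq formula) : bool :=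
  all (fun phi => z \notin fv phi) l.

Lemma fresh_cons z phi l : fresh z (phi :: l) = (z \notin fv phi) && fresh z l.
Proof. by []. Qed.

Lemma fresh_map_subst z t l : fresh z l -> [seq subst z t phi | phi <- l] = l.
Proof. by elim: l => //= phi l IH /andP[/subst_id-> /IH->]. Qed.

Lemma in_fv_seq_mset z l : in_fv z (seq_mset l) <-> ~~ fresh z l.
Proof.
rewrite /fresh -has_predC; split=> [[phi]|/hasP[phi lphi]].
  by rewrite mem_seq_mset => lphi zphi; apply/hasP; exists phi => //=; rewrite negbK.
by rewrite /= negbK => zphi; exists phi; rewrite ?mem_seq_mset.
Qed.

Ltac subset := let v := fresh in
  move=> v; rewrite !inE; repeat (case: (v == _) => //=); rewrite ?orbT //.

(** * Derived rules, identity and contraction *)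

Section Calculus.

Variable L : nat.

Definition derives (l : seq formula) : Prop := derivable L (seq_mset l).

Lemma derives_perm l l' : perm_eq l l' -> derives l -> derives l'.
Proof. by rewrite /derives => /eq_seq_msetP->. Qed.

Lemma derives_rule r l l' :
    conclusion r = seq_mset l -> side_condition r ->
    premisses r = map (@seq_mset _) l' -> (forall m, m \in l' -> derives m) -> derives l.
Proof.
rewrite /derives => <- side pr prD; apply: derivable_rule => // G; rewrite pr.
by case/mapP=> m /prD ? ->.
Qed.

Lemma derives_rule0 r l :
  conclusion r = seq_mset l -> side_condition r -> premisses r = [::] -> derives l.
Proof. by move=> c s p; apply: (@derives_rule r l [::]). Qed.

Lemma derives_rule1 r l m :
    conclusion r = seq_mset l -> side_condition r ->
    premisses r = [:: seq_mset m] -> derives m -> derives l.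
Proof. by move=> c s p Dm; apply: (@derives_rule r l [:: m]) => // ?; rewrite inE => /eqP->. Qed.

Lemma derives_rule2 r l m m' :
    conclusion r = seq_mset l -> side_condition r ->
    premisses r = [:: seq_mset m; seq_mset m'] -> derives m -> derives m' -> derives l.
Proof.
move=> c s p Dm Dm'; apply: (@derives_rule r l [:: m; m']) => // ?.
by rewrite !inE => /orP[]/eqP->.
Qed.

Lemma derives_weak1 a l : derives l -> derives (a :: l).
Proof. by apply: (@derives_rule1 (RWeak (seq_mset l) [mset a])); rewrite //= seq_mset_add. Qed.

Lemma derives_cut phi l : derives (phi :: l) -> derives (neg phi :: l) -> derives l.
Proof. by apply: (@derives_rule2 (RCut (seq_mset l) phi)); rewrite //= !seq_mset_add. Qed.

Lemma derives_initEq t u l : derives [:: Eq t u, Neq t u & l].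
Proof. by apply: (@derives_rule0 (InitEq (seq_mset l) t u)); rewrite //= seq_mset_add. Qed.

Lemma derives_And1 a b l : derives (a :: l) -> derives (b :: l) -> derives (And a b :: l).
Proof. by apply: (@derives_rule2 (RAnd (seq_mset l) a b)); rewrite //= !seq_mset_add. Qed.

Lemma derives_Or1 a b l : derives [:: a, b & l] -> derives (Or a b :: l).
Proof. by apply: (@derives_rule1 (ROr (seq_mset l) a b)); rewrite //= !seq_mset_add. Qed.

Lemma derives_All1 y z a l :
    fresh z (All y a :: l) -> free_for y (Var z) a ->
  derives (subst y (Var z) a :: l) -> derives (All y a :: l).
Proof.
move=> fz ff; apply: (@derives_rule1 (RAll (seq_mset l) y a z)); rewrite //= !seq_mset_add //.
by split=> //; rewrite in_fv_seq_mset fz.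
Qed.

Lemma derives_Ex1 y t a l :
  free_for y t a -> derives [:: subst y t a, Ex y a & l] -> derives (Ex y a :: l).
Proof.
by move=> ff; apply: (@derives_rule1 (REx (seq_mset l) y a t)); rewrite //= !seq_mset_add.
Qed.

Ltac perm := by apply: derives_perm; apply/permP => ? /=; lia.

Lemma derives_swap a b l : derives [:: a, b & l] -> derives [:: b, a & l].
Proof. perm. Qed.

(** Initial sequents give identity for equations only; induction on size does the rest, a quantifier
    being opened with a fresh variable on both sides. *)
Lemma derives_identity phi l : derives [:: phi, neg phi & l].
Proof.
have quantifier y a : (forall psi m, fsize psi < fsize (All y a) -> derives [:: psi, neg psi & m]) ->
    forall m, derives [:: All y a, Ex y (neg a) & m].
  move=> IH m; have [z] := exists_fresh (vars a ++ flatten (map fv m)).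
  rewrite mem_cat => /norP[za zm].
  have fz : free_for y (Var z) a by apply: free_for_fresh.
  apply: (@derives_All1 _ z) => //=.
    rewrite !mem_filter fv_neg (negPf (notin_fv za)) !andbF /=.
    apply/allP => psi mpsi; apply: contra zm => zpsi.
    by apply/flattenP; exists (fv psi); rewrite ?map_f.
  suff: derives [:: Ex y (neg a), subst y (Var z) a & m] by perm.
  apply: (@derives_Ex1 _ (Var z)); first by rewrite free_for_neg.
  have := IH (subst y (Var z) a) (Ex y (neg a) :: m).
  by rewrite fsize_subst neg_subst => /(_ (leqnn _)); perm.
elim/formula_size_ind: phi l => -[t u|t u|a b|a b|y a|y a] /= IH l.
- exact: derives_initEq.
- have := derives_initEq t u l; perm.
- have Da m : derives [:: a, neg a & m] by apply: IH; rewrite ltnS leq_addr.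
  have Db m : derives [:: b, neg b & m] by apply: IH; rewrite ltnS leq_addl.
  apply: derives_And1.
    suff: derives [:: Or (neg a) (neg b), a & l] by perm.
    by apply: derives_Or1; have := Da (neg b :: l); perm.
  suff: derives [:: Or (neg a) (neg b), b & l] by perm.
  by apply: derives_Or1; have := Db (neg a :: l); perm.
- have Da m : derives [:: a, neg a & m] by apply: IH; rewrite ltnS leq_addr.
  have Db m : derives [:: b, neg b & m] by apply: IH; rewrite ltnS leq_addl.
  suff: derives [:: And (neg a) (neg b), Or a b & l] by perm.
  apply: derives_And1.
    suff: derives [:: Or a b, neg a & l] by perm.
    by apply: derives_Or1; have := Da (b :: l); perm.
  suff: derives [:: Or a b, neg b & l] by perm.
  by apply: derives_Or1; have := Db (a :: l); perm.
- by apply: quantifier => psi m lt; apply: IH.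
(* The existential case is the universal one for [neg a], which has the same size as [a]. *)
- suff: derives [:: All y (neg a), Ex y (neg (neg a)) & l] by rewrite negK; perm.
  apply: quantifier => psi m lt; apply: IH; apply: leq_trans lt _.
  by rewrite /=; elim: (a) => //=; lia.
Qed.

(** Contraction is a cut on [a]: the premiss with [neg a] is an identity because [a] is already in
    [l]. *)
Lemma derives_contract a l : a \in l -> derives (a :: l) -> derives l.
Proof.
move=> al Dl; apply: (@derives_cut a) => //.
have /perm_to_rem E := al; apply: (@derives_perm [:: a, neg a & rem a l]); last exact: derives_identity.
by rewrite perm_sym; move/permP: E => E; apply/permP => P /=; rewrite E /=; lia.
Qed.

(** Sequents behave as sets: weaken to [l ++ l'], then contract the formulas of [l] one by one. *)
Lemma derives_sub l l' : {subset l <= l'} -> derives l -> derives l'.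
Proof.
move=> sub Dl; have: derives (l ++ l').
  elim: {sub} l' => [|a l' IH]; first by rewrite cats0.
  have := derives_weak1 a IH; apply: derives_perm.
  by apply/permP => P /=; rewrite !count_cat /=; lia.
elim: l sub {Dl} => //= a l IH sub Dl; apply: IH => [v vl|].
  by rewrite sub // inE vl orbT.
by apply: derives_contract Dl; rewrite mem_cat sub ?orbT ?mem_head.
Qed.

Lemma derives_id phi l : phi \in l -> neg phi \in l -> derives l.
Proof.
move=> lp ln; apply: (@derives_sub [:: phi; neg phi]); last exact: derives_identity.
by move=> v; rewrite !inE => /orP[]/eqP->.
Qed.

(** By contraction the principal formula may stay in the sequent, so this rule and the next ones ask
    only for membership. *)
Lemma derives_And a b l : And a b \in l -> derives (a :: l) -> derives (b :: l) -> derives l.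
Proof. by move=> ab Da Db; apply: derives_contract ab _; apply: derives_And1. Qed.

Lemma derives_Or a b l : Or a b \in l -> derives [:: a, b & l] -> derives l.
Proof. by move=> ab Dab; apply: derives_contract ab _; apply: derives_Or1. Qed.

Lemma derives_All z y a l :
    All y a \in l -> fresh z l -> free_for y (Var z) a ->
  derives (subst y (Var z) a :: l) -> derives l.
Proof.
move=> al fz ff Da; apply: derives_contract (al) _; apply: derives_All1 Da => //=.
by rewrite fz andbT; move/allP: fz => /(_ _ al).
Qed.

Lemma derives_Ex t y a l : Ex y a \in l -> free_for y t a -> derives (subst y t a :: l) -> derives l.
Proof.
move=> al ff Da; apply: derives_contract (al) _; apply: derives_Ex1 ff _.
by apply: derives_sub Da; subset.
Qed.

Lemma derives_initSucc t l : Neq (Succ t) Zero \in l -> derives l.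
Proof.
move=> tl; apply: derives_contract tl _.
by apply: (@derives_rule0 (InitSucc (seq_mset l) t)); rewrite //= seq_mset_add.
Qed.

Lemma derives_ref t l : derives (Neq t t :: l) -> derives l.
Proof. by apply: (@derives_rule1 (RRef (seq_mset l) t)); rewrite //= seq_mset_add. Qed.

Lemma derives_rep y u0 u1 t0 t1 l :
    Neq t0 t1 \in l -> Neq (tsubst y t0 u0) (tsubst y t0 u1) \in l ->
  derives (Neq (tsubst y t1 u0) (tsubst y t1 u1) :: l) -> derives l.
Proof.
move=> tl ul Dl; apply: derives_contract (ul) _; apply: (@derives_contract (Neq t0 t1)).
  by rewrite inE tl orbT.
apply: (@derives_rule1 (RRep (seq_mset l) t0 t1 y u0 u1)); rewrite //= ?seq_mset_add //.
by apply: derives_sub Dl; subset.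
Qed.

Lemma derives_pred t u l :
  Neq (Succ t) (Succ u) \in l -> derives (Neq t u :: l) -> derives l.
Proof.
move=> tl Dl; apply: derives_contract tl _.
apply: (@derives_rule1 (RPred (seq_mset l) t u)); rewrite //= ?seq_mset_add //.
by apply: derives_sub Dl; subset.
Qed.

Lemma derives_add0 t l : derives (Eq (Add t Zero) t :: l).
Proof.
apply: (@derives_rule1 (RAdd0 (seq_mset (Eq (Add t Zero) t :: l)) t)); rewrite //= ?seq_mset_add //.
exact/derives_swap/derives_initEq.
Qed.

Lemma derives_addS t u l : derives (Eq (Add t (Succ u)) (Succ (Add t u)) :: l).
Proof.
set e := Eq _ _.
apply: (@derives_rule1 (RAddS (seq_mset (e :: l)) t u)); rewrite //= ?seq_mset_add //.
exact/derives_swap/derives_initEq.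
Qed.

Lemma derives_mul0 t l : derives (Eq (Mul t Zero) Zero :: l).
Proof.
apply: (@derives_rule1 (RMult0 (seq_mset (Eq (Mul t Zero) Zero :: l)) t)); rewrite //= ?seq_mset_add //.
exact/derives_swap/derives_initEq.
Qed.

Lemma derives_mulS t u l : derives (Eq (Mul t (Succ u)) (Add (Mul t u) t) :: l).
Proof.
set e := Eq _ _.
apply: (@derives_rule1 (RMultS (seq_mset (e :: l)) t u)); rewrite //= ?seq_mset_add //.
exact/derives_swap/derives_initEq.
Qed.

Lemma derives_case x l :
    ~~ fresh x l -> derives [seq subst x Zero phi | phi <- l] ->
  derives [seq subst x (Succ (Var x)) phi | phi <- l] -> derives l.
Proof.
move=> xl; apply: (@derives_rule2 (RCase (seq_mset l) x)); rewrite //= ?seq_subst_seq_mset //.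
exact/in_fv_seq_mset.
Qed.

(** * Induction for Pi formulas and equality *)

Lemma derives_induction x phi l :
    Pi L phi -> fresh x l -> derives (subst x Zero phi :: l) ->
    derives [:: neg phi, subst x (Succ (Var x)) phi & l] ->
  derives (phi :: l).
Proof.
(* If [x] is not free in [phi], (case) on [x] is barred by its side condition, but the base premiss
   is then the goal itself. *)
move=> Pphi xl D0 DS; case: (boolP (x \in fv phi)) => [xphi|xphi]; last first.
  by rewrite subst_id in D0.
have substE t : seq_subst x t (seq_mset l `+` [mset phi]) =
    seq_mset l `+` [mset subst x t phi].
  by rewrite !seq_mset_add seq_subst_seq_mset /= fresh_map_subst.
have [p0 proof0] := D0; have [p1 proof1] := DS.
exists (loop (seq_mset l) x phi (subst x (Succ (Var x)) phi) p0 p1).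
rewrite -seq_mset_add1; apply: loop_proof => //.
- by rewrite in_fv_seq_mset xl.
- by exists phi; rewrite // in_msetD in_mset1 eqxx orbT.
- by rewrite substE seq_mset_add.
- by rewrite !seq_mset_add.
Qed.

Lemma derives_refl t l : derives (Eq t t :: l).
Proof. exact/derives_ref/derives_swap/derives_initEq. Qed.

(** (ref) supplies [Neq t t], whose left side is rewritten along [Neq t u]. *)
Lemma derives_sym t u l : Neq t u \in l -> derives (Neq u t :: l) -> derives l.
Proof.
move=> tl Dl; have [y yt] := exists_fresh (tvars t).
apply: (@derives_ref t); apply: (@derives_rep y (Var y) t t u); rewrite /= ?eqxx ?(tsubst_id _ yt) //.
- by rewrite inE tl orbT.
- exact: mem_head.
- by apply: derives_sub Dl; subset.
Qed.

(** Cuts move both equations to the negative side, where (rep) acts. The terms [u0] and [u1] have a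
    hole [y]; symmetry, transitivity and congruence are choices of them. *)
Lemma derives_rewrite y u0 u1 t u l :
    derives (Eq t u :: l) -> derives (Eq (tsubst y t u0) (tsubst y t u1) :: l) ->
  derives (Eq (tsubst y u u0) (tsubst y u u1) :: l).
Proof.
move=> Dtu Dt; set goal := Eq _ _.
apply: (@derives_cut (Eq t u)); first by apply: derives_sub Dtu; subset.
apply: (@derives_cut (Eq (tsubst y t u0) (tsubst y t u1))); first by apply: derives_sub Dt; subset.
apply: (@derives_rep y u0 u1 t u); [by rewrite !inE eqxx orbT | exact: mem_head |].
by apply: (@derives_id goal); rewrite /goal /= !inE eqxx ?orbT.
Qed.

Lemma derives_eq_sym t u l : derives (Eq t u :: l) -> derives (Eq u t :: l).
Proof.
move=> Dtu; have [y yt] := exists_fresh (tvars t).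
have := @derives_rewrite y (Var y) t _ _ _ Dtu.
by rewrite /= eqxx !(tsubst_id _ yt); apply; apply: derives_refl.
Qed.

Lemma derives_eq_trans u t v l : derives (Eq t u :: l) -> derives (Eq u v :: l) -> derives (Eq t v :: l).
Proof.
move=> Dtu Duv; have [y yt] := exists_fresh (tvars t).
have := @derives_rewrite y t (Var y) _ _ _ Duv.
by rewrite /= eqxx !(tsubst_id _ yt); apply.
Qed.

Lemma derives_eq_Succ t u l : derives (Eq t u :: l) -> derives (Eq (Succ t) (Succ u) :: l).
Proof.
move=> Dtu; have [y yt] := exists_fresh (tvars t).
have := @derives_rewrite y (Succ t) (Succ (Var y)) _ _ _ Dtu.
by rewrite /= eqxx !(tsubst_id _ yt); apply; apply: derives_refl.
Qed.

(** The fresh variable opening the universal formula also instantiates the existential one; [avoid]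
    lists further variables it must differ from. *)
Lemma derives_All_Ex (avoid : seq nat) x a b l :
    All x a \in l -> Ex x b \in l ->
    (forall z, z \notin avoid ->
       derives [:: subst x (Var z) a, subst x (Var z) b & l]) ->
  derives l.
Proof.
move=> al bl Dz; have [z] := exists_fresh (avoid ++ vars a ++ vars b ++ flatten (map fv l)).
rewrite !mem_cat => /norP[zs /norP[za /norP[zb zl]]].
apply: (derives_All (z := z) al); last apply: (@derives_Ex (Var z) x b).
- by apply/allP => psi lpsi; apply: contra zl => zpsi; apply/flattenP; exists (fv psi); rewrite ?map_f.
- exact: free_for_fresh.
- by rewrite inE bl orbT.
- exact: free_for_fresh.
- by apply: derives_sub (Dz z zs); subset.
Qed.

(** (rep) rewrites inequalities only; induction on size extends it to all formulas. *)
Lemma derives_leibniz y t u phi l :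
    free_for y t phi -> free_for y u phi ->
  derives [:: Neq t u, neg (subst y t phi), subst y u phi & l].
Proof.
elim/formula_size_ind: phi l => phi IH l ft fu.
(* Once [y] is known to be free, the [free_for] hypotheses at a quantifier say that its variable is
   not in [t] or [u]. *)
case: (boolP (y \in fv phi)) => [yphi|yphi]; last first.
  by rewrite !subst_id //; apply: (@derives_id phi); rewrite !inE eqxx ?orbT.
case: phi IH ft fu yphi => [v w|v w|a b|a b|x a|x a] /= IH.
- move=> _ _ _; apply: (@derives_rep y v w t u); rewrite ?inE ?eqxx ?orbT //.
  by apply: (@derives_id (Eq (tsubst y u v) (tsubst y u w))); rewrite /= !inE eqxx ?orbT.
(* Here the inequality available to (rep) contains [u], so the rewriting goes from [u] to [t]. *)
- move=> _ _ _; apply: (@derives_sym t u); rewrite ?inE ?eqxx ?orbT //.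
  apply: (@derives_rep y v w u t); rewrite ?inE ?eqxx ?orbT //.
  by apply: (@derives_id (Eq (tsubst y t v) (tsubst y t w))); rewrite /= !inE eqxx ?orbT.
- case/andP=> at' bt /andP[au bu] _.
  apply: (@derives_Or (neg (subst y t a)) (neg (subst y t b))); first by rewrite !inE eqxx ?orbT.
  apply: (@derives_And (subst y u a) (subst y u b)); first by rewrite !inE eqxx ?orbT.
    by apply: derives_sub (IH a _ l at' au); [subset | rewrite ltnS leq_addr].
  by apply: derives_sub (IH b _ l bt bu); [subset | rewrite ltnS leq_addl].
- case/andP=> at' bt /andP[au bu] _.
  apply: (@derives_Or (subst y u a) (subst y u b)); first by rewrite !inE eqxx ?orbT.
  apply: (@derives_And (neg (subst y t a)) (neg (subst y t b))); first by rewrite !inE eqxx ?orbT.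
    by apply: derives_sub (IH a _ l at' au); [subset | rewrite ltnS leq_addr].
  by apply: derives_sub (IH b _ l bt bu); [subset | rewrite ltnS leq_addl].
- move=> ft fu ya; move: ft fu; rewrite ya /= => /andP[xt ft] /andP[xu fu].
  have xy : x != y by move: ya; rewrite mem_filter eq_sym => /andP[].
  rewrite (negPf xy); apply: (@derives_All_Ex [:: y] x (subst y u a) (neg (subst y t a))).
  + by rewrite !inE eqxx ?orbT.
  + by rewrite !inE eqxx ?orbT.
  move=> z; rewrite inE => zy; rewrite -neg_subst !subst_comm //.
  apply: derives_sub (IH (subst x (Var z) a) _ l _ _); first by subset.
  + by rewrite fsize_subst.
  + exact: free_for_subst.
  + exact: free_for_subst.
- move=> ft fu ya; move: ft fu; rewrite ya /= => /andP[xt ft] /andP[xu fu].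
  have xy : x != y by move: ya; rewrite mem_filter eq_sym => /andP[].
  rewrite (negPf xy); apply: (@derives_All_Ex [:: y] x (neg (subst y t a)) (subst y u a)).
  + by rewrite !inE eqxx ?orbT.
  + by rewrite !inE eqxx ?orbT.
  move=> z; rewrite inE => zy; rewrite -neg_subst !subst_comm //.
  apply: derives_sub (IH (subst x (Var z) a) _ l _ _); first by subset.
  + by rewrite fsize_subst.
  + exact: free_for_subst.
  + exact: free_for_subst.
Qed.

(** * Simulation of natural deduction *)

(** With no other formula in the sequent, each quantified variable is its own active variable; the
    context [l] is added last. *)
Lemma derives_univ_closure phi : derives [:: phi] -> forall l, derives (univ_closure phi :: l).
Proof.
move=> Dphi l; suff Dc : derives [:: univ_closure phi].
  by apply: derives_sub Dc => v; rewrite !inE => ->.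
rewrite /univ_closure; elim: undup => //= y s IH.
apply: (@derives_All1 y y); rewrite ?subst_var //=; first by rewrite mem_filter eqxx.
exact: free_for_self.
Qed.

Lemma fresh_neg z l : fresh z (map neg l) = fresh z l.
Proof. by rewrite /fresh all_map; apply: eq_all => phi /=; rewrite fv_neg. Qed.

Lemma freshP z l : reflect (forall psi, psi \in l -> z \notin fv psi) (fresh z l).
Proof. exact: allP. Qed.

(** Open assumptions become negated side formulas. Introductions are rules of the calculus, and
    eliminations are cuts on the eliminated formula. *)
Lemma nd_sound (T : formula -> Prop) :
    (forall phi, T phi -> forall l, derives (phi :: l)) ->
  forall G phi, nd T G phi -> derives (phi :: map neg G).
Proof.
move=> TD G phi; elim=> {G phi}.
- by move=> G phi /TD.
- move=> G phi Gphi; apply: (@derives_id phi); first exact: mem_head.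
  by rewrite inE map_f ?orbT.
- by move=> G a b _ Da _ Db; apply: derives_And1.
- move=> G a b _ Dab; apply: (@derives_cut (And a b)); first by apply: derives_sub Dab; subset.
  apply: derives_Or1; apply: (@derives_id a); by rewrite !inE eqxx ?orbT.
- move=> G a b _ Dab; apply: (@derives_cut (And a b)); first by apply: derives_sub Dab; subset.
  apply: derives_Or1; apply: (@derives_id b); by rewrite !inE eqxx ?orbT.
- by move=> G a b _ Da; apply: derives_Or1; apply: derives_sub Da; subset.
- by move=> G a b _ Db; apply: derives_Or1; apply: derives_sub Db; subset.
- move=> G a b c _ Dab _ Da _ Db; apply: (@derives_cut (Or a b)); first by apply: derives_sub Dab; subset.
  by apply: derives_And1; [apply: derives_sub Da | apply: derives_sub Db]; subset.
- move=> G y a z za zG ff _ Da; apply: derives_All1 Da => //.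
  by apply/andP; split=> //; move/freshP: zG; rewrite -fresh_neg.
- move=> G y a t ff _ Da; apply: (@derives_cut (All y a)); first by apply: derives_sub Da; subset.
  apply: (@derives_Ex1 _ t); first by rewrite free_for_neg.
  by apply: (@derives_id (subst y t a)); rewrite ?neg_subst !inE eqxx ?orbT.
- by move=> G y a t ff _ Da; apply: (derives_Ex1 ff); apply: derives_sub Da; subset.
- move=> G y a z c za zc zG ff _ Da _ Dc.
  apply: (@derives_cut (Ex y a)); first by apply: derives_sub Da; subset.
  apply: (@derives_All1 _ z).
  + by apply/and3P; split; rewrite //= ?fv_neg //; move/freshP: zG; rewrite -fresh_neg.
  + by rewrite free_for_neg.
  + by rewrite -neg_subst; apply: derives_sub Dc; subset.
- move=> G a _ Da _ Dna; apply: (@derives_cut a); first by apply: derives_sub Da; subset.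
  by apply: derives_sub Dna; subset.
(* The assumption [neg a] appears as [a], and [bot], being [Neq Zero Zero], is removed by (ref). *)
- move=> G a _; rewrite /= negK => Da.
  by apply: (@derives_ref Zero); apply: derives_sub Da; subset.
- by move=> G t; apply: derives_refl.
- move=> G y a t u ft fu _ Dtu _ Dt.
  apply: (@derives_cut (Eq t u)); first by apply: derives_sub Dtu; subset.
  apply: (@derives_cut (subst y t a)); first by apply: derives_sub Dt; subset.
  by apply: derives_sub (derives_leibniz (map neg G) ft fu); subset.
Qed.

(** * Axioms of Robinson's arithmetic and Sigma induction *)

Lemma Pi_Eq t u : Pi L (Eq t u).
Proof. by have [] := Delta0_Sigma_Pi L (Delta0_Eq t u). Qed.

Lemma Pi_Or a b : 0 < L -> Pi L a -> Pi L b -> Pi L (Or a b).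
Proof. by case: L => // n _; apply: all_Or. Qed.

Lemma Pi_All y a : 0 < L -> Pi L a -> Pi L (All y a).
Proof. by case: L => // n _; apply: all_All. Qed.

(** Addition recurses on its second argument, so this law about the first is proved by induction,
    with an empty context to keep [k] fresh. *)
Lemma derives_zero_add k l : derives (Eq (Add Zero (Var k)) (Var k) :: l).
Proof.
suff D1 : derives [:: Eq (Add Zero (Var k)) (Var k)] by apply: derives_sub D1 => v; rewrite !inE => ->.
apply: (@derives_induction k) => //=; rewrite ?eqxx; [exact: Pi_Eq | exact: derives_add0 |].
apply: derives_swap; apply: (@derives_eq_trans (Succ (Add Zero (Var k)))); first exact: derives_addS.
exact/derives_eq_Succ/derives_initEq.
Qed.

Lemma derives_succ_add x k l : x != k ->
  derives (Eq (Add (Succ (Var x)) (Var k)) (Succ (Add (Var x) (Var k))) :: l).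
Proof.
move=> xk; set e := Eq _ _.
suff D1 : derives [:: e] by apply: derives_sub D1 => v; rewrite !inE => ->.
apply: (@derives_induction k); rewrite // ?/e /= ?eqxx ?(negPf xk); first exact: Pi_Eq.
  apply: (@derives_eq_trans (Succ (Var x))); first exact: derives_add0.
  exact/derives_eq_Succ/derives_eq_sym/derives_add0.
apply: derives_swap; apply: (@derives_eq_trans (Succ (Add (Succ (Var x)) (Var k)))); first exact: derives_addS.
apply: derives_eq_Succ; apply: (@derives_eq_trans (Succ (Add (Var x) (Var k)))); first exact: derives_initEq.
exact/derives_eq_sym/derives_addS.
Qed.

Lemma derives_Q_axiom phi : Q_axiom phi -> derives [:: phi].
Proof.
case=> /=.
- by apply: (@derives_initSucc (Var 0)); apply: mem_head.
- apply: derives_Or1; apply: (@derives_pred (Var 0) (Var 1)); first exact: mem_head.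
  by apply: (@derives_id (Eq (Var 0) (Var 1))); rewrite !inE eqxx ?orbT.
(* The rule (case) on the free variable leaves reflexivity at zero, and at a successor its
   predecessor is the witness. *)
- apply: (@derives_case 0) => //=; apply: derives_Or1; first exact: derives_refl.
  apply: derives_swap; apply: (@derives_Ex1 _ (Var 0)) => //=.
  exact: derives_refl.
- exact: derives_add0.
- exact: derives_addS.
- exact: derives_mul0.
- exact: derives_mulS.
Qed.

(* Induction on [k] for [forall x (x + k = a -> ~ phi x)], which is Pi_L when [phi]
   is Sigma_L: a counterexample [a] to [phi] is pushed down to [0]. *)
Lemma derives_Sigma_induction x phi : 0 < L -> Sigma L phi -> derives [:: induction x phi].
Proof.
move=> L0 Sphi; have [a] := exists_fresh (x :: vars phi).
rewrite inE => /norP[ax aphi].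
have [k] := exists_fresh (x :: a :: vars phi).
rewrite !inE => /norP[kx /norP[ka kphi]].
have xa : x != a by rewrite eq_sym.
have xk : x != k by rewrite eq_sym.
have ak : a != k by rewrite eq_sym.
(* The hypotheses of induction appear negated: [base] denies the formula at zero, and [step] claims
   a place where the inductive step fails. *)
apply: derives_Or1; rewrite /= negK; apply: derives_Or1.
set base := neg _; set step := Ex x _.
have afv : a \notin fv phi by apply: notin_fv.
have kfv : k \notin fv phi by apply: notin_fv.
have fresh_hyps z : z = x \/ z != x /\ z \notin fv phi -> fresh z [:: base; step].
  case=> [->|[zx zphi]]; rewrite /base /step /= fv_neg mem_filter mem_cat !fv_neg.
    by rewrite eqxx fv_subst_closed.
  by rewrite (negPf zphi) !(negPf (fv_subst_fresh x zphi _)) ?inE ?andbF.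
apply: (@derives_All a x phi); first by rewrite !inE eqxx ?orbT.
- have /and3P[ab as' _] := fresh_hyps a (or_intror (conj ax afv)).
  by rewrite /= ab as' mem_filter (negPf afv) andbF.
- exact: free_for_fresh.
(* At zero [psi] refutes [phi] at [a], and at [a] it refutes [phi] at zero; induction leads from the
   former to the latter. *)
pose psi t := All x (Or (Neq (Add (Var x) t) (Var a)) (neg phi)).
pose l := [:: subst x (Var a) phi; base; step].
suff: derives l by apply: derives_sub; rewrite /l; subset.
have psiE t : subst k t (psi (Var k)) = psi t.
  rewrite /psi /= (negPf xk) (negPf ak) eqxx subst_id //.
  by rewrite fv_neg.
have xl : fresh x l.
  by apply/andP; split; [rewrite fv_subst_closed ?inE | apply: fresh_hyps; left].
have kl : fresh k l.
  apply/andP; split; first by rewrite fv_subst_fresh ?inE.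
  by apply: fresh_hyps; right.
have xpsi t : x \notin fv (psi t) by apply: notin_fv_All.
have Dpsi : derives (psi (Var k) :: l).
  apply: (@derives_induction k) => //.
  + apply/Pi_All/Pi_Or => //; last exact: (Sigma_Pi_neg L).1.
    by have [] := Delta0_Sigma_Pi L (Delta0_Neq (Add (Var x) (Var k)) (Var a)).
  + rewrite psiE; apply: (@derives_All1 x x); rewrite ?subst_var ?free_for_self //.
      by rewrite fresh_cons xl andbT; apply: xpsi.
    (* At zero, [x + 0 = a] gives [x = a], and Leibniz's law carries [phi] from [x] to [a]. *)
    apply: derives_Or1; apply: (@derives_cut (Eq (Var x) (Var a))).
      apply: (@derives_eq_trans (Add (Var x) Zero)); first exact/derives_eq_sym/derives_add0.
      exact: derives_initEq.
    have := derives_leibniz [::] (@free_for_self x (Var x) phi (fun _ => id)) (free_for_fresh x aphi).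
    by rewrite subst_var; apply: derives_sub; rewrite /l; subset.
  rewrite psiE; apply: derives_swap; apply: (@derives_All1 x x); rewrite ?subst_var ?free_for_self //.
    by rewrite 2!fresh_cons xl andbT fv_neg; apply/andP; split; apply: xpsi.
  apply: derives_Or1.
  (* The inductive step for [phi] at [x] yields [phi] at the successor of [x]. *)
  apply: (@derives_Ex (Var x) x (And phi (neg (subst x (Succ (Var x)) phi)))).
  + by rewrite !inE eqxx ?orbT.
  + exact: free_for_self.
  rewrite subst_var; apply: derives_And1.
    by apply: (@derives_id phi); rewrite !inE eqxx ?orbT.
  (* The induction hypothesis is used at the successor of [x], as [s(x) + k = x + s(k) = a]. *)
  apply: (@derives_Ex (Succ (Var x)) x (neg (Or (Neq (Add (Var x) (Var k)) (Var a)) (neg phi)))).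
  + by rewrite !inE eqxx ?orbT.
  + exact: free_for_self.
  rewrite /= negK eqxx (negPf kx) (negPf ax); apply: derives_And1.
    apply: (@derives_eq_trans (Succ (Add (Var x) (Var k)))); first exact: derives_succ_add.
    apply: (@derives_eq_trans (Add (Var x) (Succ (Var k)))); first exact/derives_eq_sym/derives_addS.
    by apply: (@derives_id (Eq (Add (Var x) (Succ (Var k))) (Var a))); rewrite !inE eqxx ?orbT.
  by apply: (@derives_id (subst x (Succ (Var x)) phi)); rewrite !inE eqxx ?orbT.
have Dall : derives (All k (psi (Var k)) :: l).
  apply: (@derives_All1 k k); rewrite ?subst_var ?free_for_self //.
  by apply/andP; split=> //; apply: notin_fv_All.
apply: derives_cut Dall _; apply: (@derives_Ex (Var a) k (neg (psi (Var k)))).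
- exact: mem_head.
- by rewrite free_for_neg /= !inE xa free_for_neg free_for_fresh ?orbT.
(* With [k] set to [a], the witness is zero: [0 + a = a], and [base] closes the other conjunct. *)
rewrite -neg_subst psiE /= negK; apply: (@derives_Ex1 x Zero); first exact: free_for_self.
rewrite /= eqxx (negPf ax); apply: derives_And1; first exact: derives_zero_add.
by apply: (@derives_id (subst x Zero phi)); rewrite !inE eqxx ?orbT.
Qed.

End Calculus.

Theorem corollary3p4 (n : nat) (phi : formula) :
  provable (ISigma n.+1) phi -> S_provable n phi.
Proof.
move=> prf; have [p [der res reg root]] : derives n.+1 [:: phi].
  apply: (nd_sound (T := ISigma n.+1) _ prf) => psi.
  case=> [chi /derives_Q_axiom Qchi l|x chi Schi l]; apply: derives_univ_closure => //.
  exact: derives_Sigma_induction.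
exists p; split=> //; last first.
  by rewrite root; congr Some; apply/msetP => v; rewrite mset_seqE msetnE /= addn0 eq_sym; case: eqP.
(* Forgetting the Pi conditions on the tail leaves an infinite proof in the plain sense. *)
by split=> // b /res[m []]; exists m.
Qed.
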